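(* Let $\mu$ be a unimodular probability measure on $\mathcal G_\ast$ such that $\deg_G(o)>0$ for $\mu$-a.e. $[G,o]$ and such that, for some $D\in\mathbb N$, $\deg_G(v)\le D$ for all $v\in V(G)$ for $\mu$-a.e. $[G,o]$. Let $\eta\in L^2(\mu,\mathbb R)$, let $W:\mathbb R\to\mathbb R$ be convex, even and continuously differentiable, and consider the game with action set $\mathbb R$, private cost $f([G,o],a)=-\eta([G,o])\,a$ and interaction cost $h([G,o,v],a,b)=W(a-b)$. If $x^\ast\in\mathcal H=L^2(\mu,\mathbb R)$ satisfies $$(\Delta_Wx^\ast)([G,o])=\frac{\eta([G,o])}{\deg_G(o)}\quad\text{for }\mu\text{-a.e. }[G,o],$$ where $$(\Delta_Wx)([G,o])=\frac1{\deg_G(o)}\sum_{v\sim o}W'\big(x([G,o])-x([G,v])\big),$$ then $x^\ast$ is a quenched Nash equilibrium.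
   Context: Graphs. All graphs $G=(V,E)$ are simple (undirected, no loops or multiple edges), locally finite, with finite or countably infinite vertex set $V=V(G)$; $u\sim v$ means $\{u,v\}\in E$. A rooted graph $(G,o)$ is a graph with a distinguished vertex $o$; rooted isomorphisms are graph isomorphisms mapping root to root, and $[G,o]$ is the isomorphism class. $B_r(G,o)$ is the rooted subgraph induced by the vertices at graph distance at most $r$ from $o$. $\mathcal G_\ast$ is the set of isomorphism classes of countable, connected, rooted graphs with metric $d_\ast([G,o],[G',o'])=\inf_{r\in\mathbb N_0}\{2^{-r}:B_r(G,o)\cong B_r(G',o')\}$. $\mathcal G_{\ast\ast}$ is the analogous space of isomorphism classes $[G,o_1,o_2]$ of countable, connected, doubly rooted graphs (isomorphisms preserve both roots in order), with the analogous metric $d_{\ast\ast}$. Both carry Borel $\sigma$-fields. A probability measure $\mu$ on $\mathcal G_\ast$ is unimodular if for every measurable $T:\mathcal G_{\ast\ast}\to[0,\infty]$, $\int\sum_{v\in V(G)}T([G,o,v])\,\mu(d[G,o])=\int\sum_{v\in V(G)}T([G,v,o])\,\mu(d[G,o])$. Game. $\mathcal H=L^2(\mu,\mathbb R)$ is the space of square-$\mu$-integrable measurable $x:\mathcal G_\ast\to\mathbb R$. For such $x$ and a countable connected graph $G$, write $x^G_v=x([G,v])$ and $x^G=(x^G_v)_{v\in V(G)}$. The cost of player $v\in V(G)$ is $J^G_v(x^G)=f([G,v],x^G_v)+\sum_{u\sim v}h([G,v,u],x^G_v,x^G_u)$. An element $x\in\mathcal H$ is a quenched Nash equilibrium if for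 $\mu$-a.e. $[G,o]$, $J^G_o(x^G)\le J^G_o(a,x^G_{-o})$ for all $a\in\mathbb R$, where $(a,x^G_{-o})$ is $x^G$ with the root action $x^G_o$ replaced by $a$. *)

(* Defs.v *)
From HB Require Import structures.
From mathcomp Require Import all_boot all_order all_algebra finmap.
From mathcomp Require Import all_classical all_reals all_analysis.
From mathcomp Require Import measurable_realfun.

Set Implicit Arguments.
Unset Strict Implicit.
Unset Printing Implicit Defensive.

Import Order.TTheory GRing.Theory Num.Theory.
Import numFieldNormedType.Exports.

Local Open Scope classical_set_scope.
Local Open Scope ring_scope.

(* Up to isomorphism the vertex set of a finite or countably infinite graph
   is a subset of nat, so graphs are simple, locally finite graphs on such
   subsets. *)
Record graph := Graph {
  vset : set nat ;
  adj : rel nat ;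
  adj_vset : forall u v, adj u v -> vset u ;
  adj_sym : symmetric adj ;
  adj_irr : irreflexive adj ;
  adj_fin : forall u, finite_set [set v | adj u v]
}.

Definition dist_le (G : graph) (r : nat) (u v : nat) : Prop :=
  exists p : seq nat, [/\ path (adj G) u p, last u p = v & (size p <= r)%N].

Definition connected_graph (G : graph) : Prop :=
  forall u v, vset G u -> vset G v -> exists r, dist_le G r u v.

(* The vertices at distance at most r from one of the roots listed in s. *)
Definition gball (G : graph) (s : seq nat) (r : nat) : set nat :=
  [set v | exists2 o, o \in s & dist_le G r o v].

(* The subgraph of G induced by A, rooted at s, is isomorphic to the subgraph
   of G' induced by A', rooted at s'. *)
Definition iso_on (G G' : graph) (A A' : set nat) (s s' : seq nat) : Prop :=
  exists f : nat -> nat, [/\ set_bij A A' f,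
    forall u v, A u -> A v -> adj G u v = adj G' (f u) (f v) &
    map f s = s'].

(* Connected graphs with k.+1 ordered, possibly equal, roots. *)
Record cgraph := CGraph {
  cgraph_graph :> graph ;
  cgraph_conn : connected_graph cgraph_graph
}.

Definition vertex (G : cgraph) : Type := set_type (vset G).
HB.instance Definition _ (G : cgraph) := Choice.on (vertex G).

Record rgraph (k : nat) := RGraph {
  rg_graph :> cgraph ;
  rg_tuple : k.+1.-tuple (vertex rg_graph)
}.

HB.instance Definition _ k := gen_eqMixin (rgraph k).
HB.instance Definition _ k := gen_choiceMixin (rgraph k).

Definition roots k (g : rgraph k) : seq nat := map \val (rg_tuple g).

Definition rooted_iso k (g h : rgraph k) : Prop :=
  iso_on g h (vset g) (vset h) (roots g) (roots h).

Definition ball_iso k (r : nat) (g h : rgraph k) : Prop :=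
  iso_on g h (gball g (roots g) r) (gball h (roots h) r) (roots g) (roots h).

Lemma iso_on_refl G A s : iso_on G G A A s s.
Proof.
exists id; split => //; last exact: map_id.
by split => // v Av; exists v.
Qed.

Lemma iso_on_sym G G' A A' s s' : (forall x, x \in s -> A x) ->
  iso_on G G' A A' s s' -> iso_on G' G A' A s' s.
Proof.
move=> sA [f [[fA finj fsurj] fadj fs]].
have [g gP] : exists g : nat -> nat, forall v, A' v -> A (g v) /\ f (g v) = v.
  have /choice[g gP] : forall v, exists u, A' v -> A u /\ f u = v.
    move=> v; have [/fsurj[u Au fu]|] := pselect (A' v); first by exists u.
    by move=> nA; exists 0%N.
  by exists g.
have gfE u : A u -> g (f u) = u.
  move=> Au; have [Ag fg] := gP _ (fA _ Au).
  by apply: finj => //; rewrite inE.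
exists g; split.
- split.
  + by move=> v /gP[].
  + move=> u v; rewrite !inE => Au Av guv.
    by rewrite -(gP _ Au).2 -(gP _ Av).2 guv.
  + by move=> u Au; exists (f u); [exact: fA|exact: gfE].
- move=> u v Au Av; have [Agu fgu] := gP _ Au; have [Agv fgv] := gP _ Av.
  by rewrite (fadj _ _ Agu Agv) fgu fgv.
- rewrite -fs -map_comp -[RHS]map_id; apply/eq_in_map => x xs /=.
  by rewrite gfE//; exact: sA.
Qed.

Lemma iso_on_trans G1 G2 G3 A1 A2 A3 s1 s2 s3 :
  iso_on G1 G2 A1 A2 s1 s2 -> iso_on G2 G3 A2 A3 s2 s3 ->
  iso_on G1 G3 A1 A3 s1 s3.
Proof.
move=> [f [bf fadj fs]] [g [bg gadj gs]]; exists (g \o f); split.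
- case: bf bg => [fA fi fs'] [gA gi gs']; split.
  + by move=> u /fA/gA.
  + move=> u v; rewrite !inE => Au Av /gi fuv; apply: fi; rewrite ?inE//.
    by apply: fuv; rewrite inE; exact: fA.
  + by move=> w /gs'[v /fs'[u Au <-] <-]; exists u.
- move=> u v Au Av; case: bf => fA _ _.
  by rewrite (fadj _ _ Au Av) gadj//; exact: fA.
- by rewrite map_comp fs.
Qed.

Lemma dist_leS G r u v : dist_le G r.+1 u v <->
  u = v \/ exists2 w, dist_le G r u w & adj G w v.
Proof.
split=> [[p]|].
  elim/last_ind: p => [[_ /= <- _]|p x _ []]; first by left.
  rewrite rcons_path last_rcons size_rcons => /andP[pp lx] <- sp.
  by right; exists (last u p) => //; exists p.
move=> [<-|[w [p [pp lp sp]] wv]]; first by exists [::].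
exists (rcons p v); rewrite rcons_path last_rcons size_rcons pp lp wv.
by split.
Qed.

Lemma gball0 G s v : v \in s -> gball G s 0 v.
Proof. by move=> vs; exists v => //; exists [::]. Qed.

Lemma gball0_in G s v : gball G s 0 v -> v \in s.
Proof. by move=> [ o os [p [_ <-]]]; rewrite leqn0 size_eq0 => /eqP ->. Qed.

Lemma gball_le G s r m : (m <= r)%N -> gball G s m `<=` gball G s r.
Proof.
move=> mr v [ o os [p [pp lp sp]]]; exists o => //; exists p; split => //.
exact: leq_trans mr.
Qed.

Lemma gball_roots G s r v : v \in s -> gball G s r v.
Proof. by move=> /(@gball0 G); exact: gball_le. Qed.

Lemma gballS G s r v : gball G s r.+1 v <->
  v \in s \/ exists2 w, gball G s r w & adj G w v.
Proof.
split=> [[ o os /dist_leS[<-|[w ow wv]]]|[vs|[w [ o os ow] wv]]].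
- by left.
- by right; exists w => //; exists o.
- exact: gball_roots.
- by exists o => //; apply/dist_leS; right; exists w.
Qed.

Lemma gball_vset G s r : (forall v, v \in s -> vset G v) ->
  gball G s r `<=` vset G.
Proof.
move=> sG; elim: r => [v /gball0_in|r IH v]; first exact: sG.
move=> /gballS[/sG //|[w _ wv]].
by apply: (@adj_vset _ _ w); rewrite adj_sym.
Qed.

Lemma gball_fin G s r : finite_set (gball G s r).
Proof.
elim: r => [|r IH].
  apply: (@sub_finite_set _ _ [set` s]); last exact: finite_seq.
  by move=> v /gball0_in.
apply: (@sub_finite_set _ _
    ([set` s] `|` \bigcup_(w in gball G s r) [set v | adj G w v])).
  by move=> v /gballS[vs|[w wb wv]]; [left|right; exists w].
rewrite finite_setU; split; first exact: finite_seq.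
by apply: bigcup_finite => // w _; exact: adj_fin.
Qed.

Lemma iso_on_gball_map G G' A A' s s' f r :
  set_fun A A' f ->
  (forall u v, A u -> A v -> adj G u v = adj G' (f u) (f v)) ->
  map f s = s' -> gball G s r `<=` A ->
  forall v, gball G s r v -> gball G' s' r (f v).
Proof.
move=> fA fadj <-; elim: r => [|r IH] BA v.
  by move=> /gball0_in vs; apply: gball0; exact: map_f.
have BA' : gball G s r `<=` A.
  by apply: subset_trans BA; exact: gball_le.
move=> Bv; have Av := BA _ Bv.
apply/gballS; move: Bv => /gballS[vs|[w wB wv]]; first by left; exact: map_f.
by right; exists (f w); [exact: IH|rewrite -fadj//; exact: BA'].
Qed.

Lemma iso_on_gball_surj G G' A A' s s' f r :
  set_bij A A' f ->
  (forall u v, A u -> A v -> adj G u v = adj G' (f u) (f v)) ->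
  map f s = s' -> gball G s r `<=` A -> gball G' s' r `<=` A' ->
  set_surj (gball G s r) (gball G' s' r) f.
Proof.
move=> [fA finj fsurj] fadj fs; elim: r => [|r IH] BA BA' v.
  move=> /gball0_in; rewrite -fs => /mapP[u us ->].
  by exists u => //; exact: gball0.
move=> Bv; have [u Au fu] := fsurj _ (BA' _ Bv).
exists u => //; apply/gballS.
move: Bv => /gballS[|[w wB wv]].
  rewrite -fs -fu => /mapP[x xs fux]; left.
  by rewrite (finj u x) ?inE//; apply: BA; exact: gball_roots.
have [x xB fx] : exists2 x, gball G s r x & f x = w.
  apply: IH wB; [apply: subset_trans BA|apply: subset_trans BA'];
    exact: gball_le.
right; exists x => //; rewrite fadj ?fx ?fu//; apply: BA; exact: gball_le xB.
Qed.

Lemma iso_on_gball G G' A A' s s' r :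
  gball G s r `<=` A -> gball G' s' r `<=` A' ->
  iso_on G G' A A' s s' ->
  iso_on G G' (gball G s r) (gball G' s' r) s s'.
Proof.
move=> BA BA' [f [fbij fadj fs]]; have [fA finj fsurj] := fbij.
exists f; split => //; last by move=> u v Bu Bv; apply: fadj; exact: BA.
split.
- exact: iso_on_gball_map fA fadj fs BA.
- by move=> u v; rewrite !inE => Bu Bv; apply: finj; rewrite inE; exact: BA.
- exact: iso_on_gball_surj fbij fadj fs BA BA'.
Qed.

Lemma roots_vset k (g : rgraph k) v : v \in roots g -> vset g v.
Proof. by move=> /mapP[x _ ->]; have := valP x; rewrite inE. Qed.

Lemma ball_iso_le k r m (g h : rgraph k) : (m <= r)%N ->
  ball_iso r g h -> ball_iso m g h.
Proof. by move=> mr; apply: iso_on_gball; exact: gball_le. Qed.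

Lemma ball_isoC k r (g h : rgraph k) : ball_iso r g h -> ball_iso r h g.
Proof. by apply: iso_on_sym => x; exact: gball_roots. Qed.

Lemma rooted_iso_refl k (g : rgraph k) : rooted_iso g g.
Proof. exact: iso_on_refl. Qed.

Lemma rooted_iso_sym k (g h : rgraph k) : rooted_iso g h -> rooted_iso h g.
Proof. by apply: iso_on_sym => x; exact: roots_vset. Qed.

Lemma rooted_iso_trans k (g h l : rgraph k) :
  rooted_iso g h -> rooted_iso h l -> rooted_iso g l.
Proof. exact: iso_on_trans. Qed.

Lemma rooted_iso_ball k r (g h : rgraph k) : rooted_iso g h -> ball_iso r g h.
Proof.
by apply: iso_on_gball; apply: gball_vset => v; exact: roots_vset.
Qed.

Lemma gball_cover k (g : rgraph k) v : vset g v ->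
  exists r, gball g (roots g) r v.
Proof.
move=> gv; pose o := thead (rg_tuple g).
have ors : \val o \in roots g by apply: map_f; exact: mem_tnth.
have [r rP] := cgraph_conn (roots_vset ors) gv.
by exists r, (\val o).
Qed.

Lemma ultra_finite (U : set_system nat) (f : nat -> nat) (A : set nat) :
  UltraFilter U -> finite_set A -> U [set r | A (f r)] ->
  exists2 w, A w & U [set r | f r = w].
Proof.
move=> UU /finite_seqP[s ->]; elim: s => [|x s IH] /= Us.
  by have /filter_ex[] := Us.
have [Ux|Ux] := in_ultra_setVsetC [set r | f r = x] UU.
  by exists x => //=; rewrite inE eqxx.
have [|w ws Uw] := IH; last by exists w => //=; rewrite inE ws orbT.
by apply: filterS (filterI Us Ux) => r /= [/[!inE]/orP[/eqP|]].
Qed.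

(* A limit along a free ultrafilter of isomorphisms between balls of growing
   radius is an isomorphism. *)
Lemma ball_iso_all k (g h : rgraph k) :
  (forall r, ball_iso r g h) -> rooted_iso g h.
Proof.
move=> /choice[F FP].
have [U [UU leU]] := ultraFilterLemma (@eventually_filter).
have UI A B : U A -> U B -> U (A `&` B) by exact: filterI.
have Uex A : U A -> exists r, A r by exact: filter_ex.
have Uge m : U [set r | (m <= r)%N] by apply: leU; exists m.
have FB r m v : (m <= r)%N -> gball g (roots g) m v ->
    gball h (roots h) m (F r v).
  move=> mr; have [[FA _ _] Fadj Fs] := FP r.
  by apply: (iso_on_gball_map FA Fadj Fs); exact: gball_le.
have /choice[f fP] : forall v, exists w, vset g v ->
    vset h w /\ U [set r | F r v = w].
  move=> v; have [gv|] := pselect (vset g v); last by exists 0%N.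
  have [m mv] := gball_cover gv.
  have [|w wB Uw] := @ultra_finite U (F ^~ v) _ UU (gball_fin h (roots h) m).
    by apply: filterS (Uge m) => r /= mr; exact: FB.
  by exists w => _; split => //; apply: gball_vset wB => x; exact: roots_vset.
have ball_near v : vset g v -> U [set r | gball g (roots g) r v].
  move=> /gball_cover[m mv]; apply: filterS (Uge m) => r /= mr.
  exact: gball_le mv.
exists f; split.
- split.
  + by move=> v /fP[].
  + move=> u v; rewrite !inE => gu gv fuv.
    have := UI _ _ (UI _ _ (ball_near _ gu) (ball_near _ gv))
                    (UI _ _ (fP _ gu).2 (fP _ gv).2).
    move=> /(Uex _)[r [/= [Bu Bv] [Fu Fv]]].
    have [[_ Finj _] _ _] := FP r.
    by apply: Finj; rewrite ?inE// Fu Fv.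
  + move=> w hw; have [m mw] := gball_cover hw.
    have /choice[G GP] : forall r, exists v, (m <= r)%N ->
        gball g (roots g) m v /\ F r v = w.
      move=> r; have [mr|rm] := leqP m r; last by exists 0%N.
      have [Fbij Fadj Fs] := FP r.
      have [v vB Fv] := iso_on_gball_surj Fbij Fadj Fs
        (@gball_le _ _ _ _ mr) (@gball_le _ _ _ _ mr) mw.
      by exists v.
    have [|v vB Uv] := @ultra_finite U G _ UU (gball_fin g (roots g) m).
      by apply: filterS (Uge m) => r /= mr; have [] := GP r mr.
    have gv : vset g v by apply: gball_vset vB => x; exact: roots_vset.
    exists v => //.
    have /(Uex _)[r /= [[mr Gr] Fr]] :=
      UI _ _ (UI _ _ (Uge m) Uv) (fP _ gv).2.
    by rewrite -Fr -Gr; have [] := GP r mr.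
- move=> u v gu gv.
  have := UI _ _ (UI _ _ (ball_near _ gu) (ball_near _ gv))
                  (UI _ _ (fP _ gu).2 (fP _ gv).2).
  move=> /(Uex _)[r [/= [Bu Bv] [<- <-]]].
  by have [_ Fadj _] := FP r; exact: Fadj.
- rewrite -(_ : map (F 0%N) (roots g) = roots h); last by have [] := FP 0%N.
  apply/eq_in_map => o os.
  have /(Uex _)[r /= <-] := (fP _ (roots_vset os)).2.
  have [_ _ F0] := FP 0%N; have [_ _ Fr] := FP r.
  by move/eq_in_map : (etrans Fr (esym F0)); exact.
Qed.

Definition rooted_isob k : rel (rgraph k) := fun g h => `[< rooted_iso g h >].

Lemma rooted_isob_refl k : reflexive (@rooted_isob k).
Proof. by move=> g; apply/asboolP; exact: rooted_iso_refl. Qed.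

Lemma rooted_isob_sym k : symmetric (@rooted_isob k).
Proof. by move=> g h; apply/asboolP/asboolP; exact: rooted_iso_sym. Qed.

Lemma rooted_isob_trans k : transitive (@rooted_isob k).
Proof.
move=> h g l /asboolP gh /asboolP hl; apply/asboolP.
exact: rooted_iso_trans gh hl.
Qed.

Canonical rooted_equiv k : equiv_rel (rgraph k) :=
  EquivRel (@rooted_isob k)
    (@rooted_isob_refl k) (@rooted_isob_sym k) (@rooted_isob_trans k).

(* The parameter R only fixes the field of values of the metric. *)
Definition rspace (R : realType) (k : nat) : Type :=
  {eq_quot (rooted_equiv k)}%qT.

HB.instance Definition _ (R : realType) k :=
  Choice.copy (rspace R k) {eq_quot (rooted_equiv k)}%qT.

Definition rclass (R : realType) k (g : rgraph k) : rspace R k :=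
  (\pi_({eq_quot (rooted_equiv k)}) g)%qT.

Definition rrepr (R : realType) k (c : rspace R k) : rgraph k :=
  repr (c : {eq_quot (rooted_equiv k)}%qT).

Lemma rreprK R k : cancel (@rrepr R k) (@rclass R k).
Proof. by move=> c; exact: reprK. Qed.

Lemma rclassP R k (g h : rgraph k) :
  rclass R g = rclass R h <-> rooted_iso g h.
Proof.
split=> [/eqmodP /asboolP //|gh]; by apply/eqmodP; apply/asboolP.
Qed.

(* Distances are infima of subsets of [0, 1], so the infimum of the empty set
   is 1: this matters only for two or more roots, since a ball of radius 0
   around a single root is a single vertex. *)
Definition rdist (R : realType) k (c d : rspace R k) : R :=
  inf ([set 2 ^- r | r in [set r | ball_iso r (rrepr c) (rrepr d)]]
       `|` [set 1]).

Lemma rdistE (R : realType) k (g h : rgraph k) :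
  rdist (rclass R g) (rclass R h) =
  inf ([set 2 ^- r | r in [set r | ball_iso r g h]] `|` [set 1]).
Proof.
have reprP (l : rgraph k) r : ball_iso r (rrepr (rclass R l)) l.
  by apply: rooted_iso_ball; apply/(@rclassP R); rewrite rreprK.
rewrite /rdist; congr (inf (_ `|` _)).
apply/seteqP; split => _ [r /= rP <-]; exists r => //=.
  exact: iso_on_trans (iso_on_trans (ball_isoC (reprP g r)) rP) (reprP h r).
exact: iso_on_trans (iso_on_trans (reprP g r) rP) (ball_isoC (reprP h r)).
Qed.

Section rdist_lemmas.
Variables (R : realType) (k : nat).
Implicit Types c d e : rspace R k.

Let D c d : set R :=
  [set 2 ^- r | r in [set r | ball_iso r (rrepr c) (rrepr d)]] `|` [set 1].

Let D0 c d : D c d !=set0. Proof. by exists 1; right. Qed.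

Let Dge0 c d : lbound (D c d) 0.
Proof. by move=> _ [[r _ <-]| ->]//; rewrite invr_ge0 exprn_ge0. Qed.

Let rdist_le c d x : D c d x -> rdist c d <= x.
Proof. by apply: ge_inf; exists 0; exact: Dge0. Qed.

Let rdist_lt_iso c d r : rdist c d < 2 ^- r -> ball_iso r (rrepr c) (rrepr d).
Proof.
move=> /(inf_lt (D0 c d))[_ [[q /= qP <-]| ->]].
  rewrite ltf_pV2 ?posrE ?exprn_gt0// ltr_eXn2l ?ltr1n// => /ltnW rq.
  exact: ball_iso_le qP.
by rewrite ltNge invf_le1 ?exprn_gt0// exprn_ege1// ler1n.
Qed.

Lemma rdistxx c : rdist c c = 0.
Proof.
have d0 : 0 <= rdist c c by apply: lb_le_inf; [exact: D0|exact: Dge0].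
apply/eqP; rewrite eq_le d0 andbT leNgt; apply/negP => e0.
have [r _ /(_ r (leqnn r))] := near_infty_natSinv_expn_lt (PosNum e0).
rewrite /= div1r ltNge => /negP; apply; apply: rdist_le; left; exists r => //=.
exact: iso_on_refl.
Qed.

Lemma rdist_positivity c d : rdist c d = 0 -> c = d.
Proof.
move=> cd0; rewrite -(rreprK c) -(rreprK d); apply/rclassP.
apply: ball_iso_all => r; apply: rdist_lt_iso.
by rewrite cd0 invr_gt0 exprn_gt0.
Qed.

Lemma rdist_sym c d : rdist c d = rdist d c.
Proof.
rewrite /rdist; congr (inf (_ `|` _)).
by apply/seteqP; split => x [r /= /ball_isoC rP <-]; exists r.
Qed.

Lemma rdist_triangle d c e : rdist c e <= rdist c d + rdist d e.
Proof.
rewrite -lerBlDr; apply: lb_le_inf; [exact: D0|move=> x cdx].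
rewrite lerBlDr addrC -lerBlDr; apply: lb_le_inf; [exact: D0|move=> y dey].
rewrite lerBlDr addrC.
have ce1 : rdist c e <= 1 by apply: rdist_le; right.
move: (cdx) => [[r rP rx]|x1]; last first.
  by rewrite (le_trans ce1)// x1 lerDl (Dge0 dey).
move: (dey) => [[q qP qy]|y1]; last first.
  by rewrite (le_trans ce1)// y1 lerDr (Dge0 cdx).
have ceP m : (m <= r)%N -> (m <= q)%N -> rdist c e <= 2 ^- m.
  move=> mr mq; apply: rdist_le; left; exists m => //=.
  by apply: iso_on_trans (ball_iso_le mr rP) (ball_iso_le mq qP).
have [rq|/ltnW qr] := leqP r q.
  by rewrite (le_trans (ceP r _ rq))// rx lerDl (Dge0 dey).
by rewrite (le_trans (ceP q qr _))// qy lerDr (Dge0 cdx).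
Qed.

End rdist_lemmas.

HB.instance Definition _ (R : realType) k := isMetric.Build R (rspace R k)
  (@rdistxx R k) (@rdist_positivity R k) (@rdist_sym R k)
  (@rdist_triangle R k).

Lemma single_connected (G : graph) u : vset G = [set u] -> connected_graph G.
Proof. by move=> Gu v w; rewrite Gu => -> ->; exists 0%N; exists [::]. Qed.

Definition graph1 : graph.
Proof.
refine (@Graph [set 0%N] (fun _ _ => false) _ _ _ _) => //.
by move=> u; apply: (@sub_finite_set _ _ set0).
Defined.

Definition cgraph1 : cgraph := CGraph (@single_connected graph1 0%N erefl).

Definition rgraph1 k : rgraph k :=
  @RGraph k cgraph1 (nseq_tuple _ (SigSub (mem_set (erefl : [set 0%N] 0%N)))).

HB.instance Definition _ (R : realType) k :=
  isPointed.Build (rspace R k) (rclass R (rgraph1 k)).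

HB.instance Definition _ (R : realType) k :=
  @isMeasurable.Build (sigma_display (@open (rspace R k))) (rspace R k)
    <<s (@open (rspace R k)) >> (@sigma_algebra0 _ setT (@open (rspace R k)))
    (@sigma_algebraC _ (@open (rspace R k)))
    (@sigma_algebra_bigcup _ setT (@open (rspace R k))).

(* The spaces of isomorphism classes [G, o] and [G, o, v]. *)
Notation Gstar R := (rspace R 0).
Notation Gstarstar R := (rspace R 1).

Definition class1 (R : realType) (G : cgraph) (o : vertex G) : Gstar R :=
  rclass R (@RGraph 0 G [tuple o]).

Definition class2 (R : realType) (G : cgraph) (o v : vertex G) :
    Gstarstar R :=
  rclass R (@RGraph 1 G [tuple o; v]).

Definition root (g : rgraph 0) : vertex g := thead (rg_tuple g).

Definition nbr (G : cgraph) (v : vertex G) : set (vertex G) :=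
  [set u | adj G (\val v) (\val u)].

Definition deg (G : cgraph) (v : vertex G) : nat := #|` fset_set (nbr v)|%fset.

(* P holds for mu-a.e. [G, o]; quantifying over all pairs (G, o) in the class
   is harmless since only isomorphism invariant P are used. *)
Definition ae_rooted (R : realType) (mu : probability (Gstar R) R)
    (P : forall G : cgraph, vertex G -> Prop) : Prop :=
  {ae mu, forall c, forall (G : cgraph) (o : vertex G),
    c = class1 R o -> P G o}.

(* The integrands are functions of the class of (G, o) (see transport_class),
   and are evaluated at a representative. *)
Definition out_transport (R : realType) (T : Gstarstar R -> \bar R)
    (G : cgraph) (o : vertex G) : \bar R :=
  \esum_(v in [set: vertex G]) T (class2 R o v).

Definition in_transport (R : realType) (T : Gstarstar R -> \bar R)
    (G : cgraph) (o : vertex G) : \bar R :=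
  \esum_(v in [set: vertex G]) T (class2 R v o).

Definition unimodular (R : realType) (mu : probability (Gstar R) R) : Prop :=
  forall T : Gstarstar R -> \bar R,
    measurable_fun [set: Gstarstar R] T -> (forall y, (0 <= T y)%E) ->
    (\int[mu]_c out_transport T (root (rrepr c)) =
     \int[mu]_c in_transport T (root (rrepr c)))%E.

Lemma class1_iso (R : realType) (G G' : cgraph) (o : vertex G)
    (o' : vertex G') : class1 R o = class1 R o' ->
  exists phi : vertex G -> vertex G', [/\ set_bij setT setT phi, phi o = o',
    (forall u v, adj G (\val u) (\val v) = adj G' (\val (phi u)) (\val (phi v)))
    & forall u v, class2 R u v = class2 R (phi u) (phi v)].
Proof.
move=> /rclassP[f [[fV finj fsurj] fadj [fo]]].
pose phi (u : vertex G) : vertex G' :=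
  SigSub (mem_set (fV _ (set_mem (valP u)))).
have phi_adj u v : adj G (\val u) (\val v) = adj G' (\val (phi u)) (\val (phi v)).
  by rewrite fadj//; apply: set_mem; exact: valP.
exists phi; split => //.
- split=> //.
  + move=> u v _ _ /(congr1 \val) /= fuv; apply: val_inj.
    by apply: finj fuv; exact: valP.
  + move=> w _; have [u Gu fu] := fsurj _ (set_mem (valP w)).
    by exists (SigSub (mem_set Gu)) => //; apply: val_inj.
- exact: val_inj.
- by move=> u v; apply/rclassP; exists f.
Qed.

Lemma transport_class (R : realType) (T : Gstarstar R -> \bar R)
    (G G' : cgraph) (o : vertex G) (o' : vertex G') :
  class1 R o = class1 R o' ->
  out_transport T o = out_transport T o' /\
  in_transport T o = in_transport T o'.
Proof.
move=> /class1_iso[phi [phib <- _ phi2]].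
rewrite /out_transport /in_transport !(reindex_esum _ _ _ _ phib).
by split; apply: eq_esum => v _; rewrite phi2.
Qed.

(* The action profile x^G. *)
Definition profile (R : realType) (x : Gstar R -> R) (G : cgraph)
    (v : vertex G) : R :=
  x (class1 R v).
Arguments profile [R] x G v.

Definition deviate (R : realType) (G : cgraph) (y : vertex G -> R)
    (o : vertex G) (a : R) : vertex G -> R :=
  fun v => if v == o then a else y v.

Definition cost (R : realType) (f : Gstar R -> R -> R)
    (h : Gstarstar R -> R -> R -> R) (G : cgraph) (v : vertex G)
    (y : vertex G -> R) : R :=
  f (class1 R v) (y v) + \sum_(u \in nbr v) h (class2 R v u) (y v) (y u).

Definition quenched_nash (R : realType) (mu : probability (Gstar R) R)
    (f : Gstar R -> R -> R) (h : Gstarstar R -> R -> R -> R)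
    (x : Gstar R -> R) : Prop :=
  x \in Lfun mu 2%:E /\
  ae_rooted mu (fun G o => forall a : R,
    cost f h o (profile x G) <= cost f h o (deviate (profile x G) o a)).

Definition laplacian (R : realType) (W : R -> R) (x : Gstar R -> R)
    (G : cgraph) (o : vertex G) : R :=
  (deg o)%:R^-1 * \sum_(v \in nbr o) derive1 W (x (class1 R o) - x (class1 R v)).

(* Main.v *)
(* With the neighbours' actions fixed, the cost of the root is convex in its
   own action and its derivative at [x*(o)] is [deg(o)] times the defect of the
   equation [Delta_W x* = eta / deg], hence zero.  So the root action is
   a minimizer. *)
Require Import Defs.
From mathcomp Require Import all_boot all_order all_algebra finmap.
From mathcomp Require Import all_classical all_reals all_analysis.
From mathcomp Require Import measurable_realfun lra.

Import Order.TTheory GRing.Theory Num.Theory.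
Import numFieldNormedType.Exports.

Local Open Scope classical_set_scope.
Local Open Scope ring_scope.

(** By convexity, for [0 < t <= 1] the quotient [(W (c + t * (b - c)) - W c) / t] is at most
    [W b - W c]; let [t] tend to 0. *)
Lemma convex_tangent {R : realType} {W : R -> R} {c : R} (b : R) :
  convex_function [set: R^o] W -> derivable W c 1 ->
  W c + (b - c) * derive1 W c <= W b.
Proof.
move=> W_convex dW.
have /derivable1_diffP W_diff := dW.
have dWv : derivable W c (b - c) by exact: diff_derivable.
have DW : 'D_(b - c) W c = (b - c) * derive1 W c.
  by rewrite deriveE// diff1E.
(* The two-sided limit is replaced by the one from the right, since convexity bounds the quotient
   only for positive [t]. *)
rewrite -lerBrDl -DW /derive cvg_at_rightE//.
apply: limr_le.
  by apply/cvg_ex; exists ('D_(b - c) W c); apply: cvg_dnbhs_at_right; exact: dWv.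
near=> t.
have t0 : 0 < t by [].
have t1 : t <= 1 by near: t; exact: nbhs_right_le.
have := W_convex (Itv01 (ltW t0) t1) b c (mem_set I) (mem_set I).
rewrite !convRE /= /unstable.onem => Wt.
rewrite /GRing.scale /= ler_pdivrMl//.
rewrite (_ : t * (b - c) + c = t * b + (1 - t) * c); last by lra.
lra.
Unshelve. all: by end_near. Qed.

Lemma finite_nbr {G : cgraph} (v : vertex G) : finite_set (nbr v).
Proof.
apply: (@finite_preimage _ _ [set u | adj G (\val v) u] \val).
  by move=> u w _ _; exact: val_inj.
exact: adj_fin.
Qed.

Theorem proposition4p5 (R : realType) (mu : probability (Gstar R) R)
    (mu_unimodular : unimodular mu)
    (deg_gt0 : ae_rooted mu (fun G o => (0 < deg o)%N))
    (deg_bounded : exists D : nat,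
      ae_rooted mu (fun G o => forall v : vertex G, (deg v <= D)%N))
    (eta : Gstar R -> R) (eta_L2 : eta \in Lfun mu 2%:E)
    (W : R -> R) (W_convex : convex_function [set: R^o] W)
    (W_even : forall t : R, W (- t) = W t)
    (W_derivable : forall t : R, derivable W t 1)
    (W_C1 : continuous (derive1 W : R -> R))
    (x : Gstar R -> R) (x_L2 : x \in Lfun mu 2%:E)
    (x_eq : ae_rooted mu (fun G o =>
      laplacian W x o = eta (class1 R o) / (deg o)%:R)) :
  quenched_nash mu
    (fun (c : Gstar R) (a : R) => - eta c * a)
    (fun (_ : Gstarstar R) (a b : R) => W (a - b))
    x.
Proof.
split=> //.
apply: filterS2 deg_gt0 x_eq => c deg0 lap G o cE a.
move: deg0 lap => /(_ G o cE) deg0 /(_ G o cE).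
(* Cancelling the factor [1 / deg o], nonzero by [deg0], leaves the first-order condition at the
   root. *)
rewrite /laplacian /cost mulrC => /mulIf lap.
have {}lap : \sum_(v \in nbr o) derive1 W (x (class1 R o) - x (class1 R v)) =
             eta (class1 R o).
  by apply: lap; rewrite invr_neq0// pnatr_eq0 -lt0n.
rewrite /deviate eqxx /profile.
(* No vertex neighbours itself, so the deviation leaves the neighbours' actions unchanged. *)
rewrite [leRHS](_ : _ = - eta (class1 R o) * a +
    \sum_(u \in nbr o) W (a - x (class1 R u))); last first.
  congr (_ + _); apply: eq_fsbigr => u; rewrite inE /nbr /= => ou.
  by case: eqP => // uo; rewrite uo adj_irr in ou.
rewrite -lap !(fsbig_finite _ _ (finite_nbr o)).
set s := fset_set _.
set xo := x (class1 R o).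
(* Tangent bound at each [xo - x (class1 R u)]. The increment [a - xo] is the same for all
   neighbours, so the linear terms add up to [a - xo] times the sum that equals [eta] at the
   root. *)
have : \sum_(u <- s) (W (xo - x (class1 R u)) +
    (a - xo) * derive1 W (xo - x (class1 R u))) <=
    \sum_(u <- s) W (a - x (class1 R u)).
  apply: ler_sum => u _.
  have := convex_tangent (a - x (class1 R u)) W_convex
    (W_derivable (xo - x (class1 R u))).
  by rewrite (_ : a - _ - (_ - _) = a - xo)//; lra.
rewrite big_split /= -mulr_sumr.
lra.
Qed.
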